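(* Let $f:\mathbb{R}^n\to\mathbb{R}$ and $g:\mathbb{R}^n\to\mathbb{R}^m$ be twice continuously differentiable, let $\Lambda\subseteq\mathbb{R}^m$ be closed, and let $\bar x$ be a local optimal solution of the problem (P): $\min f(x)$ s.t. $g(x)\in\Lambda$. Let $d\in C(\bar x)$ be such that the set-valued map $M(x):=g(x)-\Lambda$ is metrically subregular at $(\bar x,0)$ in direction $d$ and $T^2_\Lambda(g(\bar x);\nabla g(\bar x)d)\neq\emptyset$. Then there exists a directional M-multiplier $\lambda\in\Lambda(\bar x;d)$ such that for every set $A\subseteq\mathbb{R}^m$ satisfying $A\supseteq \nabla g(\bar x)T^2_{\mathcal F}(\bar x;d)+\nabla^2 g(\bar x)(d,d)$ one has $$\nabla^2_{xx}L(\bar x,\lambda)(d,d)-\hat\sigma_{T^2_\Lambda(g(\bar x);\nabla g(\bar x)d),A}(\lambda)\ge 0.$$ In particular, there exists a multiplier $\lambda\in\Lambda(\bar x;d)$ such that $$\nabla^2_{xx}L(\bar x,\lambda)(d,d)-\hat\sigma_{T^2_\Lambda(g(\bar x);\nabla g(\bar x)d)}(\lambda)\ge 0.$$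
   Context: $\mathcal F:=\{x\in\mathbb{R}^n: g(x)\in\Lambda\}$ is the feasible set. $\nabla g(x)\in\mathbb{R}^{m\times n}$ is the Jacobian, $\nabla f(x)$ is viewed as a row vector, and $\nabla^2 g(x)(d,d):=(d^T\nabla^2 g_1(x)d,\dots,d^T\nabla^2 g_m(x)d)^T$; likewise $\nabla^2 f(x)(d,d)=d^T\nabla^2f(x)d$. The Lagrangian is $L(x,\lambda):=f(x)+g(x)^T\lambda$; $\nabla_xL,\nabla^2_{xx}L$ are derivatives in $x$. Tangent objects: for $x\in S$, $T_S(x):=\{d: \exists t_k\downarrow0,\ d_k\to d,\ x+t_kd_k\in S\}$. For $d\in T_S(x)$, the outer second-order tangent set is $T^2_S(x;d):=\{w:\exists t_k\downarrow 0,\ w_k\to w,\ x+t_kd+\tfrac12t_k^2w_k\in S\}$. Critical cone: $C(\bar x):=\{d:\nabla g(\bar x)d\in T_\Lambda(g(\bar x)),\ \nabla f(\bar x)d\le0\}$. Normal cones: for $x\in S$, $\widehat N_S(x):=\{v:\langle v,x'-x\rangle\le o(\|x'-x\|)\ \forall x'\in S\}$ (empty if $x\notin S$); limiting normal cone $N_S(x):=\{v:\exists x_k\to x,\ x_k\in S,\ v_k\to v,\ v_k\in\widehat N_S(x_k)\}$ (empty if $x\notin S$); directional limiting normal cone $N_S(x;d):=\{v:\exists t_k\downarrow0,\ d_k\to d,\ v_k\to v,\ v_k\in\widehat N_S(x+t_kd_k)\}$. Directional M-multiplier set: $\Lambda(\bar x;d):=\{\lambda\in\mathbb{R}^m:\nabla_xL(\bar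 x,\lambda)=0,\ \lambda\in N_\Lambda(g(\bar x);\nabla g(\bar x)d)\}$. Directional metric subregularity: $M(x)=g(x)-\Lambda$ is metrically subregular at $(\bar x,0)$ in direction $d$ if there are $\kappa,\rho,\delta>0$ with $\mathrm{dist}(x,\mathcal F)\le\kappa\,\mathrm{dist}(g(x),\Lambda)$ for all $x\in\bar x+V_{\rho,\delta}(d)$, where $V_{\rho,\delta}(d):=\{w:\|w\|<\rho,\ \big\|\,\|d\|w-\|w\|d\,\big\|\le\delta\|w\|\|d\|\}$. Lower generalized support functions: for a nonempty closed set $S\subseteq\mathbb{R}^m$ and $A\subseteq\mathbb{R}^m$, the extended-real-valued functions $\hat\sigma_S(\lambda):=\liminf_{\tilde\lambda\to\lambda}\inf_u\{\tilde\lambda^Tu:\tilde\lambda\in N_S(u)\}$ and $\hat\sigma_{S,A}(\lambda):=\liminf_{\tilde\lambda\to\lambda}\inf_u\{\tilde\lambda^Tu: \tilde\lambda\in N_S(u),\ u\in A\}$, with $\inf\emptyset=+\infty$; the lower limit allows $\tilde\lambda=\lambda$, i.e. $\liminf_{\tilde\lambda\to\lambda}h(\tilde\lambda)=\lim_{\delta\downarrow0}\inf_{\|\tilde\lambda-\lambda\|\le\delta}h(\tilde\lambda)$. *)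

(* Defs.v *)
(* Points of R^n are row vectors 'rV[R]_n, so
   that the Jacobian 'J g x acts on the right: the usual matrix-vector product
   (Jacobian of g at x) d is d *m 'J g x.  The norm `|x| that the library puts
   on 'rV[R]_n is the max norm; the Euclidean norm is [enorm] below.  The
   library's topology on 'rV[R]_n is the usual one. *)
From HB Require Import structures.
From mathcomp Require Import all_boot all_order all_algebra.
From mathcomp Require Import all_classical all_reals all_analysis.
Import Order.TTheory GRing.Theory Num.Theory.
Import numFieldNormedType.Exports.

Set Implicit Arguments.
Unset Strict Implicit.
Unset Printing Implicit Defensive.

Local Open Scope classical_set_scope.
Local Open Scope ring_scope.

Section Euclidean.
Context {R : realType} {n : nat}.
Implicit Types (u v : 'rV[R]_n) (S : set 'rV[R]_n).

Definition dot u v : R := \sum_(i < n) u 0 i * v 0 i.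

Definition enorm v : R := Num.sqrt (dot v v).

(* [+oo] when [S] is empty. *)
Definition edist v S : \bar R := ereal_inf [set (enorm (v - s))%:E | s in S].

End Euclidean.

Section Derivatives.
Context {R : realType} {n : nat}.
Implicit Types (f : 'rV[R]_n -> R) (x d : 'rV[R]_n).

Definition partial (i : 'I_n) f : 'rV[R]_n -> R := 'D_(delta_mx 0 i) f.

Definition grad f x : 'rV[R]_n := \row_i partial i f x.

Definition hess f x : 'M[R]_n := \matrix_(i, j) partial j (partial i f) x.

Definition hess2 f x d : R := (d *m hess f x *m d^T) 0 0.

(* Continuous Frechet differentiability on the whole space; [continuous (grad f)]
   is continuity of x |-> 'd f x in coordinates. *)
Definition C1 f : Prop := (forall x, differentiable f x) /\ continuous (grad f).

Definition C2 f : Prop := C1 f /\ forall i, C1 (partial i f).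

Context {m : nat}.
Implicit Type g : 'rV[R]_n -> 'rV[R]_m.

Definition C2vec g : Prop := forall i, C2 (fun x => g x 0 i).

Definition hess2vec g x d : 'rV[R]_m := \row_i hess2 (fun y => g y 0 i) x d.

End Derivatives.

Section VariationalGeometry.
Context {R : realType} {n : nat}.
Implicit Types (S : set 'rV[R]_n) (x d v w : 'rV[R]_n).

Definition downto0 (t : nat -> R) : Prop :=
  (forall k, 0 < t k) /\ t @ \oo --> (0 : R).

Definition tangent_cone S x : set 'rV[R]_n := [set d |
  exists (t : nat -> R) (d_ : nat -> 'rV[R]_n),
    [/\ downto0 t, d_ @ \oo --> d & forall k, S (x + t k *: d_ k)]].

Definition tangent2 S x d : set 'rV[R]_n := [set w |
  exists (t : nat -> R) (w_ : nat -> 'rV[R]_n),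
    [/\ downto0 t, w_ @ \oo --> w &
      forall k, S (x + t k *: d + (2^-1 * t k ^+ 2) *: w_ k)]].

Definition regular_normal S x : set 'rV[R]_n := [set v | S x /\
  forall e : R, 0 < e ->
    \forall y \near x, S y -> dot v (y - x) <= e * enorm (y - x)].

Definition limiting_normal S x : set 'rV[R]_n := [set v | S x /\
  exists x_ v_ : nat -> 'rV[R]_n,
    [/\ x_ @ \oo --> x, forall k, S (x_ k), v_ @ \oo --> v &
      forall k, regular_normal S (x_ k) (v_ k)]].

Definition dir_limiting_normal S x d : set 'rV[R]_n := [set v |
  exists (t : nat -> R) (d_ v_ : nat -> 'rV[R]_n),
    [/\ downto0 t, d_ @ \oo --> d, v_ @ \oo --> v &
      forall k, regular_normal S (x + t k *: d_ k) (v_ k)]].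

(* [limf_einf h (nbhs l)] is the supremum over the neighborhoods V of l of
   inf_V h; l itself belongs to every V, so h l is taken into account.
   [ereal_inf] of the empty set is [+oo]. *)
Definition lower_support S (l : 'rV[R]_n) : \bar R :=
  limf_einf (fun l' : 'rV[R]_n =>
    ereal_inf [set (dot l' u)%:E | u in [set u | limiting_normal S u l']])
  (nbhs l).

Definition lower_support_on S (A : set 'rV[R]_n) (l : 'rV[R]_n) : \bar R :=
  limf_einf (fun l' : 'rV[R]_n =>
    ereal_inf [set (dot l' u)%:E
              | u in [set u | limiting_normal S u l' /\ A u]])
  (nbhs l).

Definition dir_nbhd (rho delta : R) d : set 'rV[R]_n := [set w |
  enorm w < rho /\
  enorm (enorm d *: w - enorm w *: d) <= delta * enorm w * enorm d].

End VariationalGeometry.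

(* The problem: minimize f x subject to g x in Lam. *)
Section Problem.
Context {R : realType} {n m : nat}.
Variables (f : 'rV[R]_n -> R) (g : 'rV[R]_n -> 'rV[R]_m) (Lam : set 'rV[R]_m).
Implicit Types (x d : 'rV[R]_n) (l : 'rV[R]_m).

Definition feasible : set 'rV[R]_n := [set x | Lam (g x)].

Definition local_solution x : Prop :=
  feasible x /\ \forall y \near x, feasible y -> f x <= f y.

Definition lagrangian x l : R := f x + dot (g x) l.

Definition critical_cone x : set 'rV[R]_n :=
  [set d | tangent_cone Lam (g x) (d *m 'J g x) /\ dot (grad f x) d <= 0].

Definition dir_multipliers x d : set 'rV[R]_m := [set l |
  grad (lagrangian ^~ l) x = 0 /\
  dir_limiting_normal Lam (g x) (d *m 'J g x) l].

(* Directional metric subregularity at (x, 0) of the set-valued map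
   y |-> g y - Lam, whose distance dist(0, g y - Lam) is dist(g y, Lam). *)
Definition dir_subregular x d : Prop :=
  exists kappa rho delta : R, [/\ 0 < kappa, 0 < rho, 0 < delta &
    forall w, dir_nbhd rho delta d w ->
      (edist (x + w) feasible <= kappa%:E * edist (g (x + w)) Lam)%E].

End Problem.

(* Main.v *)
Require Import Defs.
From mathcomp Require Import all_boot all_order all_algebra.
From mathcomp Require Import all_classical all_reals all_analysis.
From mathcomp Require Import ring lra.
Import Order.TTheory GRing.Theory Num.Theory.
Import numFieldNormedType.Exports.
Local Open Scope classical_set_scope.
Local Open Scope ring_scope.

(** Write G for the Jacobian of g at xbar, c for the gradient of f, b for the
    vector of second derivatives of g along d, T for the second-order tangent
    set of Lam at g(xbar) along dG, and C for that of the feasible set at xbar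
    along d.

    Second-order expansion along the arcs xbar + t d + t^2/2 w gives two facts:
    w in C implies wG + b in T, and local optimality together with c.d <= 0
    implies c.w + beta >= 0 on C, beta being the second derivative of f along d
    ([tangent2_feasible], [tangent2_second_order]).  Directional subregularity
    provides the converse in a quantitative form ([tangent2_error_bound]):
    dist(w, C) <= kappa dist(wG + b, T) for every w.  So C is exactly the
    solution set of wG + b in T, it is nonempty because T is, and the linear
    objective c.w is bounded below on it by -beta.

    What remains is a duality statement for a linear objective and a closed,
    possibly nonconvex T ([linear_objective_multiplier]).  The infimum of c.w over
    C may not be attained, so one minimizes c.w + alpha |w|^2, treating the
    constraint by a quadratic penalty.  The error bound keeps the multipliers
    bounded; letting first the penalty grow and then alpha decrease to 0, one
    obtains l with c + l G^T = 0, and l is a limit of normals l' of T at points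
    u = wG + b with w in C such that l'.u <= beta + l'.b.  Being of this form, u
    belongs to every admissible A.  Since beta + l.b is the second derivative of
    the Lagrangian along d, this is the asserted bound on the lower support
    function; it does not depend on A, and A = setT gives the second claim.

    Finally l is a directional limiting normal of Lam.  T is the outer limit of
    the rescaled sets (Lam - g(xbar) - t dG) / (t^2/2), so its normals are limits
    of normals of these sets, that is, of normals of Lam at the points
    g(xbar) + t (dG + t/2 p) ([limiting_normal_tangent2]). *)

Set Implicit Arguments.
Unset Strict Implicit.
Unset Printing Implicit Defensive.

(** * Euclidean geometry of row vectors *)

Section Dot.
Context {R : realType} {n : nat}.
Implicit Types (u v w : 'rV[R]_n) (a e M : R).

Lemma dotC u v : dot u v = dot v u.
Proof. by apply: eq_bigr => i _; rewrite mulrC. Qed.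

Lemma dotDl u v w : dot (u + v) w = dot u w + dot v w.
Proof. by rewrite -big_split; apply: eq_bigr => i _; rewrite mxE mulrDl. Qed.

Lemma dotZl a u v : dot (a *: u) v = a * dot u v.
Proof. by rewrite /dot mulr_sumr; apply: eq_bigr => i _; rewrite mxE mulrA. Qed.

Lemma dotNl u v : dot (- u) v = - dot u v.
Proof. by rewrite -scaleN1r dotZl mulN1r. Qed.

Lemma dotBl u v w : dot (u - v) w = dot u w - dot v w.
Proof. by rewrite dotDl dotNl. Qed.

Lemma dotDr u v w : dot w (u + v) = dot w u + dot w v.
Proof. by rewrite !(dotC w) dotDl. Qed.

Lemma dotZr a u v : dot u (a *: v) = a * dot u v.
Proof. by rewrite !(dotC u) dotZl. Qed.

Lemma dotNr u v : dot u (- v) = - dot u v.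
Proof. by rewrite !(dotC u) dotNl. Qed.

Lemma dotBr u v w : dot w (u - v) = dot w u - dot w v.
Proof. by rewrite !(dotC w) dotBl. Qed.

Definition dotE := (dotDl, dotDr, dotBl, dotBr, dotNl, dotNr, dotZl, dotZr).

Lemma dotvv_ge0 u : 0 <= dot u u.
Proof. by apply: sumr_ge0 => i _; rewrite -expr2 sqr_ge0. Qed.

Lemma enorm_ge0 u : 0 <= enorm u.
Proof. exact: sqrtr_ge0. Qed.

Lemma enorm_sqr u : enorm u ^+ 2 = dot u u.
Proof. by rewrite sqr_sqrtr ?dotvv_ge0. Qed.

Lemma enormZ a u : enorm (a *: u) = `|a| * enorm u.
Proof.
by rewrite /enorm dotZl dotZr mulrA -expr2 sqrtrM ?sqr_ge0// sqrtr_sqr.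
Qed.

Lemma enormN u : enorm (- u) = enorm u.
Proof. by rewrite /enorm dotNl dotNr opprK. Qed.

Lemma enormB u v : enorm (u - v) = enorm (v - u).
Proof. by rewrite -enormN opprB. Qed.

Lemma enorm0 : enorm (0 : 'rV[R]_n) = 0.
Proof. by rewrite -(scale0r (0 : 'rV[R]_n)) enormZ normr0 mul0r. Qed.

Lemma coord_le_norm u i : `|u 0 i| <= `|u|.
Proof.
by rewrite [leRHS]/Num.Def.normr/= mx_normrE; apply: (le_bigmax _ _ (0, i)).
Qed.

Lemma norm_le_enorm u : `|u| <= enorm u.
Proof.
rewrite [leLHS]/Num.Def.normr/= mx_normrE bigmax_le ?enorm_ge0// => -[i j] _ /=.
rewrite -sqrtr_sqr /enorm ler_sqrt ?dotvv_ge0// ord1 /dot (bigD1 j)//= -expr2.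
by rewrite lerDl sumr_ge0// => k _; rewrite -expr2 sqr_ge0.
Qed.

Lemma enorm_eq0 u : enorm u = 0 -> u = 0.
Proof.
by move=> u0; apply/eqP; rewrite -normr_le0 -u0 norm_le_enorm.
Qed.

Lemma dotvv_eq0 u : dot u u = 0 -> u = 0.
Proof. by move=> u0; apply: enorm_eq0; rewrite /enorm u0 sqrtr0. Qed.

Lemma dot0l u : dot 0 u = 0.
Proof. by rewrite -(scale0r 0) dotZl mul0r. Qed.

(** Expand the square of |v| u - |u| v, which is nonnegative. *)
Lemma dot_cauchy u v : dot u v <= enorm u * enorm v.
Proof.
have := dotvv_ge0 (enorm v *: u - enorm u *: v).
rewrite !dotE -!enorm_sqr (dotC v u) => h.
have [/eqP|u0] := boolP (enorm u * enorm v == 0); last first.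
  have {}u0 : 0 < enorm u * enorm v by rewrite lt0r u0 mulr_ge0 ?enorm_ge0.
  by rewrite -(ler_pM2l u0); nra.
move=> /eqP; rewrite mulf_eq0 => /orP[] /eqP/enorm_eq0 ->.
  by rewrite dot0l enorm0 mul0r.
by rewrite dotC dot0l enorm0 mulr0.
Qed.

Lemma enormD u v : enorm (u + v) <= enorm u + enorm v.
Proof.
rewrite -(@ler_pXn2r _ 2)// ?nnegrE ?addr_ge0 ?enorm_ge0//.
rewrite enorm_sqr !dotE (dotC v u) -!enorm_sqr.
have := dot_cauchy u v; lra.
Qed.

Lemma enorm_sub u v : enorm u <= enorm v + enorm (u - v).
Proof. by rewrite -{1}(subrKC v u) enormD. Qed.

Lemma ler_sqr_enorm u v : dot u u <= dot v v -> enorm u <= enorm v.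
Proof. by move=> h; rewrite /enorm ler_sqrt ?dotvv_ge0. Qed.

End Dot.

Lemma dot_mulmx {R : realType} {n m : nat} (w : 'rV[R]_n) (l : 'rV[R]_m)
    (G : 'M[R]_(n, m)) : dot (w *m G) l = dot w (l *m G^T).
Proof.
rewrite /dot; under eq_bigr do rewrite mxE mulr_suml.
rewrite exchange_big; apply: eq_bigr => i _ /=.
rewrite mxE mulr_sumr; apply: eq_bigr => j _.
by rewrite mxE; ring.
Qed.

(** * Limits in finite dimension *)

Section Limits.
Context {R : realType} {n : nat}.
Implicit Types (u v : nat -> 'rV[R]_n) (l : 'rV[R]_n).

Lemma cvg_row {T : Type} {F : set_system T} {FF : Filter F}
    (u : T -> 'rV[R]_n) l :
  (forall i, (fun k => u k 0 i) @ F --> l 0 i) -> u @ F --> l.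
Proof.
move=> h; apply/cvgrPdist_lt => e e0.
have : \forall k \near F, forall i, `|l 0 i - u k 0 i| < e.
  by apply: filter_forall => i; exact: (cvgrPdist_lt _ _).1 (h i) _ e0.
apply: filterS => k hk.
by rewrite [ltLHS]/Num.Def.normr/= mx_normrE bigmax_lt// => -[i j] _ /=;
  rewrite ord1 !mxE.
Qed.

Lemma cvg_sum {T : Type} {F : set_system T} {FF : Filter F} {I : finType}
    (u : I -> T -> R) (a : I -> R) :
  (forall i, u i k @[k --> F] --> a i) -> (fun k => \sum_i u i k) @ F --> \sum_i a i.
Proof. by move=> h; apply: cvg_big => // x; exact: add_continuous. Qed.

Lemma cvg_coord {T : Type} {F : set_system T} {FF : Filter F}
    (u : T -> 'rV[R]_n) l i : u @ F --> l -> (fun k => u k 0 i) @ F --> l 0 i.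
Proof.
move=> h; apply: (@continuous_cvg _ _ _ F FF u (fun M : 'rV[R]_n => M 0 i)) h.
exact: coord_continuous.
Qed.

Lemma cvg_dot {T : Type} {F : set_system T} {FF : Filter F}
    (u v : T -> 'rV[R]_n) (a b : 'rV[R]_n) :
  u @ F --> a -> v @ F --> b -> (fun k => dot (u k) (v k)) @ F --> dot a b.
Proof.
move=> ua vb; apply: cvg_sum => i; apply: cvgM; exact: cvg_coord.
Qed.

Lemma cvg_enorm {T : Type} {F : set_system T} {FF : Filter F}
    (u : T -> 'rV[R]_n) (a : 'rV[R]_n) : u @ F --> a -> (fun k => enorm (u k)) @ F --> enorm a.
Proof.
move=> ua; apply: (@continuous_cvg _ _ _ F FF (fun k => dot (u k) (u k)) Num.sqrt).
  exact: sqrt_continuous.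
exact: cvg_dot.
Qed.

Lemma continuous_enorm : continuous (@enorm R n).
Proof. by move=> v; exact: (@cvg_enorm _ (nbhs v) _ id). Qed.

Lemma compact_enorm_ball (B : R) : compact [set v : 'rV[R]_n | enorm v <= B].
Proof.
apply: bounded_closed_compact.
  exists B; split; first exact: num_real.
  by move=> x Bx v /= vB; rewrite (le_trans (norm_le_enorm v))// (le_trans vB)// ltW.
rewrite (_ : mkset _ = enorm @^-1` [set x | x <= B])//.
apply: preimage_closed; last exact: closed_le.
by move=> v _; exact: continuous_enorm.
Qed.

Lemma infty_subseq (phi : nat -> nat) : (forall k, (k <= phi k)%N) ->
  phi @ \oo --> \oo.
Proof.
move=> h A [N _ NA]; exists N => // k /= Nk; apply: NA => /=.
exact: leq_trans (h k).
Qed.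

Lemma cvg_subseq {T : topologicalType} (u : nat -> T) (l : T) (phi : nat -> nat) :
  (forall k, (k <= phi k)%N) -> u @ \oo --> l -> (u \o phi) @ \oo --> l.
Proof. by move=> /infty_subseq h; apply: cvg_comp. Qed.

(** Compactness gives a cluster point, and phi k picks an index at least k within
    1/(k+1) of it.  The bound k <= phi k lets the other limits pass to the
    subsequence. *)
Lemma bounded_subseq u (B : R) : (forall k, enorm (u k) <= B) ->
  exists (phi : nat -> nat) l, (forall k, (k <= phi k)%N) /\ (u \o phi) @ \oo --> l.
Proof.
move=> uB.
have [|l [_ ul]] := @compact_enorm_ball B (u @ \oo) _ _.
  by apply: (@filterE _ \oo) => k /=; exact: uB.
have /choice[phi hphi] : forall k, exists j, (k <= j)%N /\ `|l - u j| < k.+1%:R^-1.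
  move=> k; have [||x [[j kj <-] hj]] :=
    ul (u @` [set j | (k <= j)%N]) (ball l k.+1%:R^-1).
  - by exists k => // j kj; exists j.
  - by apply: nbhsx_ballx; rewrite invr_gt0.
  - by exists j; split => //; move: hj; rewrite -ball_normE.
exists phi, l; split; first by move=> k; case: (hphi k).
apply/cvgrPdist_lt => e e0; near=> k.
rewrite (lt_trans (hphi k).2)//; near: k.
exact: near_infty_natSinv_lt (PosNum e0).
Unshelve. all: by end_near. Qed.

End Limits.

Lemma cvg_mulmx {R : realType} {n m : nat} {T : Type} {F : set_system T} {FF : Filter F}
    (u : T -> 'rV[R]_n) (a : 'rV[R]_n) (G : 'M[R]_(n, m)) :
  u @ F --> a -> (fun k => u k *m G) @ F --> a *m G.
Proof.
move=> ua; apply: cvg_row => j; under eq_fun do rewrite mxE.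
rewrite mxE; apply: cvg_sum => i; apply: cvgM; last exact: cvg_cst.
  exact: cvg_coord.
Qed.

Lemma cvg_natSinv {R : realType} : (fun k => k.+1%:R^-1 : R) @ \oo --> (0 : R).
Proof.
apply/cvgrPdist_lt => e e0; near=> k; rewrite sub0r normrN ger0_norm//.
near: k; exact: near_infty_natSinv_lt (PosNum e0).
Unshelve. all: by end_near. Qed.

Lemma cvg0_squeeze {R : realType} (u v : nat -> R) :
  (forall k, 0 <= u k <= v k) -> v @ \oo --> (0 : R) -> u @ \oo --> (0 : R).
Proof.
move=> uv v0; apply: (squeeze_cvgr _ (cvg_cst 0) v0).
by near=> k; exact: uv.
Unshelve. all: by end_near. Qed.

Lemma cvg_of_enorm {R : realType} {n : nat} (u : nat -> 'rV[R]_n)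
    (l : 'rV[R]_n) (e : nat -> R) :
  (forall k, enorm (u k - l) <= e k) -> e @ \oo --> (0 : R) -> u @ \oo --> l.
Proof.
move=> ue e0; apply/cvgrPdist_lt => r r0; near=> k.
rewrite distrC (le_lt_trans (norm_le_enorm _))// (le_lt_trans (ue k))//.
by near: k; exact: (cvgr_lt _ e0).
Unshelve. all: by end_near. Qed.

Lemma enorm_cvgP {R : realType} {n : nat} (u : nat -> 'rV[R]_n)
    (l : 'rV[R]_n) :
  u @ \oo --> l -> forall e : R, 0 < e -> \forall k \near \oo, enorm (u k - l) < e.
Proof.
move=> ul e e0; apply: (cvgr_lt (enorm (l - l))); last by rewrite subrr enorm0.
by apply: cvg_enorm; apply: cvgB => //; exact: cvg_cst.
Qed.

Lemma cvg_eq_cst {R : realType} {n : nat} (u : nat -> 'rV[R]_n) (l a : 'rV[R]_n) :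
  (forall k, u k = a) -> u @ \oo --> l -> l = a.
Proof.
move=> ua ul; rewrite -(norm_cvg_lim ul).
have -> : u = cst a by apply/funext => k; exact: ua.
exact: norm_lim_cst.
Qed.

(** * Minimizers and nearest points *)

(** Coercivity relative to one point of S: the sublevel set of x0 in S lies in
    the compact K, so that minimizing over S and over S intersected with K is
    the same. *)
Lemma coercive_min {R : realType} {T : topologicalType} (S K : set T)
    (phi : T -> R) x0 :
  closed S -> compact K -> continuous phi -> S x0 ->
  (forall x, S x -> phi x <= phi x0 -> K x) ->
  exists x, S x /\ forall y, S y -> phi x <= phi y.
Proof.
move=> cS cK cphi Sx0 hK.
have [||x] := @compact_EVT_min T R phi (S `&` K) _ _ (continuous_subspaceT cphi).
- by exists x0; split => //; exact: hK.
- by rewrite setIC; exact: compact_closedI.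
rewrite inE => -[Sx Kx] xmin; exists x; split => // y Sy.
have [yx0|/ltW x0y] := leP (phi y) (phi x0).
  by apply: xmin; rewrite inE; split => //; exact: hK.
by apply: le_trans x0y; apply: xmin; rewrite inE; split => //; exact: hK.
Qed.

Lemma continuous_dotvv {R : realType} {n : nat} (q : 'rV[R]_n) :
  continuous (fun y : 'rV[R]_n => dot (q - y) (q - y)).
Proof.
move=> y; apply: (@cvg_dot _ _ _ (nbhs y) _ (fun y => q - y) (fun y => q - y));
  by apply: cvgB; [exact: cvg_cst|exact: cvg_id].
Qed.

(** * Normal cones and second-order tangent sets *)

Section NormalCones.
Context {R : realType} {n : nat}.
Implicit Types (S : set 'rV[R]_n) (x d v w u q : 'rV[R]_n) (e : R).

Lemma nearest_point S q : closed S -> S !=set0 ->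
  exists p, S p /\ forall y, S y -> enorm (q - p) <= enorm (q - y).
Proof.
move=> cS [s0 Ss0].
have [||p [Sp pmin]] := @coercive_min R _ S _ (fun y => dot (q - y) (q - y)) s0
    cS (@compact_enorm_ball R n (enorm q + enorm (q - s0))) _ Ss0.
- exact: continuous_dotvv.
- move=> y Sy /ler_sqr_enorm h /=.
  by rewrite (le_trans (enorm_sub y q))// lerD2l enormB.
by exists p; split => // y Sy; apply/ler_sqr_enorm/pmin.
Qed.

Lemma near_enorm x e : 0 < e -> \forall y \near x, enorm (y - x) < e.
Proof.
move=> e0; have h : enorm (y - x) @[y --> x] --> enorm (x - x).
  apply: (@cvg_enorm _ _ _ (nbhs x) _ (fun y => y - x)).
  by apply: cvgB; [exact: cvg_id|exact: cvg_cst].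
by apply: (cvgr_lt _ h); rewrite subrr enorm0.
Qed.

Lemma nbhs_enorm x (P : set 'rV[R]_n) : nbhs x P ->
  exists2 e, 0 < e & forall y, enorm (y - x) < e -> P y.
Proof.
move=> /nbhs_ballP[e /= e0 he]; exists e => // y yx; apply: he.
by rewrite -ball_normE /= distrC (le_lt_trans (norm_le_enorm _)).
Qed.

Lemma closed_enorm S :
  (forall x, (forall e, 0 < e -> exists2 y, S y & enorm (y - x) < e) -> S x) ->
  closed S.
Proof.
move=> h x clx; apply: h => e e0.
by have [y [Sy yx]] := clx _ (near_enorm x e0); exists y.
Qed.

Lemma closed_enormP S x : closed S ->
  (forall e, 0 < e -> exists2 y, S y & enorm (y - x) < e) -> S x.
Proof.
move=> cS h; apply: cS => V /nbhs_enorm[e e0 hV].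
by have [y Sy yx] := h e e0; exists y; split => //; exact: hV.
Qed.

Lemma edist_le S v y : S y -> (Defs.edist v S <= (enorm (v - y))%:E)%E.
Proof. by move=> Sy; apply: ereal_inf_lbound; exists y. Qed.

Lemma edist_lt S v (a : R) : (Defs.edist v S < a%:E)%E ->
  exists y, S y /\ enorm (v - y) < a.
Proof. by move=> /ereal_inf_lt[_ [y Sy <-]]; rewrite lte_fin => h; exists y. Qed.

(** Near x the quadratic term M |y - x|^2 is below e |y - x|.  Residuals of nearest
    points are normals of this kind. *)
Lemma regular_normal_quadratic S x v M : S x ->
  (forall y, S y -> dot v (y - x) <= M * dot (y - x) (y - x)) ->
  regular_normal S x v.
Proof.
move=> Sx hM; split => // e e0.
have d0 : 0 < e / (`|M| + 1) by rewrite divr_gt0// ltr_wpDl.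
near=> y => Sy.
have : enorm (y - x) < e / (`|M| + 1) by near: y; exact: near_enorm.
rewrite ltr_pdivlMr ?ltr_wpDl// => hy.
apply: (le_trans (hM _ Sy)); rewrite -enorm_sqr.
have := ler_norm M; have := enorm_ge0 (y - x); nra.
Unshelve. all: by end_near. Qed.

Lemma regular_normal_nearest S p q : S p ->
  (forall y, S y -> enorm (q - p) <= enorm (q - y)) ->
  regular_normal S p (q - p).
Proof.
move=> Sp pmin; apply: (@regular_normal_quadratic _ _ _ 1) => // y Sy.
have : enorm (q - p) ^+ 2 <= enorm (q - y) ^+ 2.
  by rewrite lerXn2r ?nnegrE ?enorm_ge0 ?pmin.
rewrite !enorm_sqr mul1r -[q - y](subrKA p) -[p - y]opprB.
move: (q - p) (y - p) => a b; rewrite !dotE (dotC b a).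
by have := dotvv_ge0 b; lra.
Qed.

Lemma regular_normalZ S x v e : 0 < e ->
  regular_normal S x v -> regular_normal S x (e *: v).
Proof.
move=> e0 [Sx hv]; split => // r r0.
have /hv : 0 < r / e by rewrite divr_gt0.
apply: filterS => y hy /hy; rewrite dotZl => {}hy.
by rewrite -ler_pdivlMl// mulrA (mulrC e^-1).
Qed.

Lemma downto0_natSinv (t : nat -> R) :
  (forall k, 0 < t k < k.+1%:R^-1) -> downto0 t.
Proof.
move=> ht; split; first by move=> k; case/andP: (ht k).
apply: cvg0_squeeze cvg_natSinv => k.
by case/andP: (ht k) => /ltW -> /ltW ->.
Qed.

Lemma downto0_subseq (t : nat -> R) (phi : nat -> nat) :
  (forall k, (k <= phi k)%N) -> downto0 t -> downto0 (t \o phi).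
Proof.
by move=> hphi [t0 tc]; split; [move=> k; exact: t0|exact: cvg_subseq].
Qed.

(** The epsilon forms of the sequential definitions turn the diagonal arguments
    behind closedness into triangle inequalities. *)
Lemma tangent2P S x d w : tangent2 S x d w <-> forall e, 0 < e ->
  exists t w', [/\ 0 < t < e, enorm (w' - w) < e &
    S (x + t *: d + (2^-1 * t ^+ 2) *: w')].
Proof.
split=> [[t [w_ [[t0 tc] wc Sk]]] e e0|h].
  have [k [tk wk]] : exists k, t k < e /\ enorm (w_ k - w) < e.
    apply: (@filter_ex _ \oo); apply: filterI.
      exact: (cvgr_lt _ tc).
    exact: enorm_cvgP.
  by exists (t k), (w_ k); split => //; rewrite t0.
have /choice[t /choice[w_ h_]] : forall k : nat, exists t w',
    [/\ 0 < t < k.+1%:R^-1, enorm (w' - w) < k.+1%:R^-1 &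
    S (x + t *: d + (2^-1 * t ^+ 2) *: w')].
  by move=> k; apply: h; rewrite invr_gt0.
exists t, w_; split.
- by apply: downto0_natSinv => k; case: (h_ k).
- by apply: cvg_of_enorm cvg_natSinv => k; case: (h_ k) => _ /ltW.
- by move=> k; case: (h_ k).
Qed.

Lemma closed_tangent2 S x d : closed (tangent2 S x d).
Proof.
apply: closed_enorm => w h; apply/tangent2P => e e0.
have e2 : 0 < e / 2 by lra.
have [u /tangent2P/(_ _ e2)[t [w' [/andP[t0 te] w'u Sw']]] uw] := h _ e2.
exists t, w'; split => //; first by rewrite t0/=; lra.
by rewrite -[w' - w](subrKA u); have := enormD (w' - u) (u - w); lra.
Qed.

Lemma dir_limiting_normalP S x d v : dir_limiting_normal S x d v <->
  forall e, 0 < e -> exists t d' v', [/\ 0 < t < e, enorm (d' - d) < e,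
    enorm (v' - v) < e & regular_normal S (x + t *: d') v'].
Proof.
split=> [[t [d_ [v_ [[t0 tc] dc vc Sk]]]] e e0|h].
  have [k [[tk dk] vk]] : exists k, (t k < e /\ enorm (d_ k - d) < e) /\
      enorm (v_ k - v) < e.
    apply: (@filter_ex _ \oo); apply: filterI; first apply: filterI.
    - exact: (cvgr_lt _ tc).
    - exact: enorm_cvgP.
    - exact: enorm_cvgP.
  by exists (t k), (d_ k), (v_ k); split => //; rewrite t0.
have /choice[t /choice[d_ /choice[v_ h_]]] : forall k : nat, exists t d' v',
    [/\ 0 < t < k.+1%:R^-1, enorm (d' - d) < k.+1%:R^-1,
    enorm (v' - v) < k.+1%:R^-1 & regular_normal S (x + t *: d') v'].
  by move=> k; apply: h; rewrite invr_gt0.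
exists t, d_, v_; split.
- by apply: downto0_natSinv => k; case: (h_ k).
- by apply: cvg_of_enorm cvg_natSinv => k; case: (h_ k) => _ /ltW.
- by apply: cvg_of_enorm cvg_natSinv => k; case: (h_ k) => _ _ /ltW.
- by move=> k; case: (h_ k).
Qed.

Lemma closed_dir_limiting_normal S x d : closed (dir_limiting_normal S x d).
Proof.
apply: closed_enorm => v h; apply/dir_limiting_normalP => e e0.
have e2 : 0 < e / 2 by lra.
have [u /dir_limiting_normalP/(_ _ e2)] := h _ e2.
move=> [t [d' [v' [/andP[t0 te] d'd v'u Sv']]]] uv.
exists t, d', v'; split => //; [by rewrite t0/=; lra|by lra|].
by rewrite -[v' - v](subrKA u); have := enormD (v' - u) (u - v); lra.
Qed.

End NormalCones.

Section NormalsOfTangent2.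
Context {R : realType} {n : nat}.
Implicit Types (S : set 'rV[R]_n) (x d v u p q : 'rV[R]_n) (t : R).

(** The sets {p | x + t d + t^2/2 p in S} are rescaled copies of S, of which
    [tangent2 S x d] is the outer limit as t decreases to 0. *)
Lemma closed_rescaled S x d t : closed S ->
  closed [set p | S (x + t *: d + (2^-1 * t ^+ 2) *: p)].
Proof.
move=> cS; apply: preimage_closed cS => p _.
apply: (@cvgD _ _ _ (nbhs p) _ (fun=> x + t *: d)); first exact: cvg_cst.
by apply: cvgZ; [exact: cvg_cst|exact: cvg_id].
Qed.

Lemma regular_normal_rescaled S x d t p v : 0 < t ->
  regular_normal [set p | S (x + t *: d + (2^-1 * t ^+ 2) *: p)] p v ->
  regular_normal S (x + t *: (d + (2^-1 * t) *: p)) v.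
Proof.
have eqn (y : 'rV[R]_n) : x + t *: d + (2^-1 * t ^+ 2) *: y =
    x + t *: (d + (2^-1 * t) *: y).
  by apply/rowP => i; rewrite !mxE; ring.
move=> t0 [/= Sp hv]; split; first by rewrite -eqn.
have c0 : 0 < 2^-1 * t ^+ 2 by rewrite mulr_gt0 ?exprn_gt0//; lra.
rewrite -eqn; set c := 2^-1 * t ^+ 2 in hv c0 *.
move=> e /hv /nbhs_enorm[r r0 hr]; near=> y => Sy.
have yr : enorm (y - (x + t *: d + c *: p)) < c * r.
  by near: y; apply: near_enorm; rewrite mulr_gt0.
set z := y - _ in yr *.
have yE : x + t *: d + c *: (p + c^-1 *: z) = y.
  by rewrite scalerDr scalerA divff ?gt_eqF// scale1r addrA /z addrC subrK.
have := hr (p + c^-1 *: z); rewrite yE addrAC subrr add0r enormZ.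
rewrite gtr0_norm ?invr_gt0// => /(_ _ Sy).
rewrite ltr_pdivrMl// => /(_ yr).
by rewrite dotZr mulrCA ler_pM2l ?invr_gt0.
Unshelve. all: by end_near. Qed.

(** A regular normal v of the outer limit T is a limit of regular normals of the
    rescaled sets.  For a small s project u + s v onto these sets: the residual
    of a projection, divided by s, is a regular normal there.  The projections
    cluster at a point p of T with |u + s v - p| <= s |v|, because the rescaled
    sets have points converging to u; and since v is regular normal to T at u,
    this forces p - u = o(s), so that the normals converge to v up to o(1). *)
Lemma regular_normal_tangent2 S x d u v : closed S ->
  regular_normal (tangent2 S x d) u v -> dir_limiting_normal S x d v.
Proof.
move=> cS [Tu hv]; apply/dir_limiting_normalP => e e0.
have e4 : 0 < e / 4 by lra.
have [r r0 hr] := nbhs_enorm (hv _ e4).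
pose s := r / (2 * enorm v + 1).
have v0 := enorm_ge0 v.
have s0 : 0 < s by rewrite divr_gt0//; lra.
have sv : 2 * (s * enorm v) < r.
  have : s * (2 * enorm v + 1) = r by rewrite divfK// gt_eqF//; lra.
  lra.
pose q := u + s *: v.
have /choice[t /choice[u_ h_]] : forall k : nat, exists t u',
    [/\ 0 < t < k.+1%:R^-1, enorm (u' - u) < k.+1%:R^-1 &
    S (x + t *: d + (2^-1 * t ^+ 2) *: u')].
  by move=> k; apply: (tangent2P _ _ _ _).1 => //; rewrite invr_gt0.
have tdown : downto0 t by apply: downto0_natSinv => k; case: (h_ k).
have /choice[p_ hp] : forall k, exists p,
    S (x + t k *: d + (2^-1 * t k ^+ 2) *: p) /\
    forall y, S (x + t k *: d + (2^-1 * t k ^+ 2) *: y) ->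
      enorm (q - p) <= enorm (q - y).
  move=> k; apply: (nearest_point q (@closed_rescaled S x d (t k) cS)).
  by exists (u_ k); case: (h_ k).
have qp k : enorm (q - p_ k) <= s * enorm v + k.+1%:R^-1.
  have [_ /ltW uk Sk] := h_ k; apply: (le_trans ((hp k).2 _ Sk)).
  rewrite /q addrAC addrC; apply: (le_trans (enormD _ _)).
  by rewrite enormZ (gtr0_norm s0) lerD2l enormB.
have pB k : enorm (p_ k) <= enorm q + (s * enorm v + 1).
  apply: (le_trans (enorm_sub (p_ k) q)); rewrite lerD2l enormB.
  by apply: (le_trans (qp k)); rewrite lerD2l invf_le1// ler1n.
have [phi [p [hphi pc]]] := bounded_subseq pB.
have Tp : tangent2 S x d p.
  exists (t \o phi), (p_ \o phi); split => //; first exact: downto0_subseq.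
  by move=> k; exact: (hp (phi k)).1.
have qpc : (q - p_ (phi k)) @[k --> \oo] --> q - p.
  by apply: cvgB => //; exact: cvg_cst.
have qp_lim : enorm (q - p) <= s * enorm v + 0.
  apply: (ler_cvg_to (cvg_enorm qpc)).
    apply: cvgD; first exact: cvg_cst.
    exact: (cvg_subseq hphi cvg_natSinv).
  by apply: filterE => k; exact: qp.
rewrite addr0 in qp_lim.
have qpE : q - p = s *: v - (p - u) by rewrite /q; apply/rowP=> i; rewrite !mxE; ring.
have pu_r : enorm (p - u) < r.
  apply: le_lt_trans sv; rewrite enormB.
  have -> : u - p = (q - p) - s *: v by rewrite qpE addrAC subrr sub0r opprB.
  apply: (le_trans (enormD _ _)); rewrite enormN enormZ (gtr0_norm s0).
  by lra.
(* expand |s v - (p - u)|^2 <= s^2 |v|^2, then use that v is regular normal *)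
have pu_small : enorm (p - u) <= 2 * s * (e / 4).
  have h1 := hr _ pu_r Tp.
  have : enorm (q - p) ^+ 2 <= (s * enorm v) ^+ 2.
    by rewrite lerXn2r ?nnegrE ?enorm_ge0// mulr_ge0// ltW.
  rewrite exprMn !enorm_sqr qpE; move: (p - u) h1 => z h1.
  rewrite !dotE (dotC z v) => h2.
  have h3 : enorm z ^+ 2 <= 2 * s * (e / 4 * enorm z).
    rewrite enorm_sqr; apply: (@le_trans _ _ (2 * s * dot v z)); first by lra.
    by rewrite ler_wpM2l//; lra.
  have := enorm_ge0 z; rewrite le_eqVlt => /orP[/eqP<-|z0].
    by apply: mulr_ge0; [apply: mulr_ge0|]; lra.
  by rewrite -(ler_pM2r z0); lra.
have vlim : enorm (s^-1 *: (q - p) - v) < e.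
  have -> : s^-1 *: (q - p) - v = - (s^-1 *: (p - u)).
    rewrite qpE scalerBr scalerA mulVf ?gt_eqF// scale1r.
    by rewrite addrAC subrr sub0r.
  rewrite enormN enormZ gtr0_norm ?invr_gt0//.
  rewrite mulrC ltr_pdivrMr//.
  by apply: (le_lt_trans pu_small); nra.
have vc : enorm (s^-1 *: (q - p_ (phi k)) - v) @[k --> \oo] -->
    enorm (s^-1 *: (q - p) - v).
  apply: cvg_enorm; apply: cvgB; last exact: cvg_cst.
  by apply: cvgZ => //; exact: cvg_cst.
have [k [[tk dk] vk]] : exists k, (t (phi k) < e /\
    enorm (d + (2^-1 * t (phi k)) *: p_ (phi k) - d) < e) /\
    enorm (s^-1 *: (q - p_ (phi k)) - v) < e.
  have [_ tc] := downto0_subseq hphi tdown.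
  apply: (@filter_ex _ \oo); apply: filterI; first apply: filterI.
  - exact: (cvgr_lt _ tc).
  - apply: enorm_cvgP => //.
    rewrite -[X in _ --> X]addr0; apply: cvgD; first exact: cvg_cst.
    rewrite -(scale0r p); apply: cvgZ => //.
    by rewrite -(mulr0 (2^-1 : R)); apply: cvgM => //; exact: cvg_cst.
  - exact: (cvgr_lt _ vc).
have [/andP[tk0 _] _ _] := h_ (phi k).
exists (t (phi k)), (d + (2^-1 * t (phi k)) *: p_ (phi k)),
  (s^-1 *: (q - p_ (phi k))); split => //; first by rewrite tk0.
apply: regular_normal_rescaled => //; apply: regular_normalZ.
  by rewrite invr_gt0.
by apply: regular_normal_nearest; [exact: (hp _).1|exact: (hp _).2].
Qed.

Lemma limiting_normal_tangent2 S x d u v : closed S ->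
  limiting_normal (tangent2 S x d) u v -> dir_limiting_normal S x d v.
Proof.
move=> cS [_ [u_ [v_ [_ _ vc hv]]]].
apply: (closed_cvg _ (@closed_dir_limiting_normal R n S x d) _ _ vc).
by apply: (@filterE _ \oo) => k; apply: regular_normal_tangent2 (hv k).
Qed.

End NormalsOfTangent2.

(** * Multipliers for a linear objective over a set with an error bound *)

Lemma quadratic_bound {R : realType} (a b M x : R) : 0 < a -> 0 <= b -> 0 <= x ->
  a * x ^+ 2 - b * x <= M -> x <= 1 + (b + `|M|) / a.
Proof.
move=> a0 b0 x0 h; rewrite leNgt; apply/negP => hx.
have M0 := normr_ge0 M; have MM := ler_norm M.
have q0 : 0 <= (b + `|M|) / a by rewrite divr_ge0 ?(ltW a0) ?addr_ge0.
have x1 : 1 < x by lra.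
have : (b + `|M|) / a < x by lra.
by rewrite ltr_pdivrMr// => h2; nra.
Qed.

Section Duality.
Context {R : realType} {n m : nat}.

Variables (T : set 'rV[R]_m) (G : 'M[R]_(n, m)) (b : 'rV[R]_m)
  (c w0 : 'rV[R]_n) (kappa : R).
Hypothesis T_closed : closed T.
Hypothesis w0_feas : T (w0 *m G + b).
Hypothesis kappa_ge0 : 0 <= kappa.
Hypothesis error_bound : forall w s, T s -> exists w',
  T (w' *m G + b) /\ enorm (w' - w) <= kappa * enorm (w *m G + b - s).

(** The objective c.w has no minimizer in general; the quadratic term makes the
    regularized problem coercive. *)
Let psi alpha (w : 'rV[R]_n) : R := dot c w + alpha * dot w w.

Let psi_bounded alpha w M : 0 < alpha -> psi alpha w <= M ->
  enorm w <= 1 + (enorm c + `|M|) / alpha.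
Proof.
move=> a0 h; apply: quadratic_bound => //; try exact: enorm_ge0.
rewrite enorm_sqr; apply: le_trans h; rewrite /psi.
have := dot_cauchy (- c) w; rewrite dotNl enormN; lra.
Qed.

(** The constraint wG + b in T is relaxed to wG + b - r in T at the cost
    rho |r|^2.  At a minimizer, wG + b - r is a nearest point of T to wG + b, so
    l = 2 rho r is a regular normal, and stationarity in w is the multiplier
    rule.  The error bound provides a feasible w' with |w' - w| <= kappa |r|;
    comparing with it bounds l independently of rho. *)
Let multiplier_penalized alpha rho : 0 < alpha -> 0 < rho ->
    2 * alpha * kappa ^+ 2 <= rho ->
  exists w l, [/\ regular_normal T (w *m G + b - (2 * rho)^-1 *: l) l,
    c + (2 * alpha) *: w + l *m G^T = 0,
    enorm l <= 4 * kappa * enorm (c + (2 * alpha) *: w) &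
    forall w', T (w' *m G + b) -> psi alpha w <= psi alpha w'].
Proof.
move=> a0 r0 rho_large.
pose S := [set z : 'rV[R]_n * 'rV[R]_m | T (z.1 *m G + b - z.2)].
pose phi (z : 'rV[R]_n * 'rV[R]_m) := psi alpha z.1 + rho * dot z.2 z.2.
have cvg1 (z : 'rV[R]_n * 'rV[R]_m) : x.1 @[x --> z] --> z.1 by exact: cvg_fst.
have cvg2 (z : 'rV[R]_n * 'rV[R]_m) : x.2 @[x --> z] --> z.2 by exact: cvg_snd.
have Scl : closed S.
  apply: preimage_closed T_closed => y _.
  apply: (@cvgB _ _ _ (nbhs y) _ (fun z => z.1 *m G + b)); last exact: cvg2.
  by apply: cvgD; [apply: cvg_mulmx; exact: cvg1|exact: cvg_cst].
have phic : continuous phi.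
  move=> z; apply: (@cvgD _ _ _ (nbhs z) _ (fun z => psi alpha z.1)).
    apply: cvgD; first by apply: cvg_dot; [exact: cvg_cst|exact: cvg1].
    by apply: cvgM; [exact: cvg_cst|apply: cvg_dot; exact: cvg1].
  by apply: cvgM; [exact: cvg_cst|apply: cvg_dot; exact: cvg2].
pose M := phi (w0, 0).
pose B1 := 1 + (enorm c + `|M|) / alpha.
pose B2 := 1 + (0 + `|M + enorm c * B1|) / rho.
pose K := [set w : 'rV[R]_n | enorm w <= B1] `*` [set r : 'rV[R]_m | enorm r <= B2].
have Kc : compact K by apply: compact_setX; exact: compact_enorm_ball.
have S0 : S (w0, 0) by rewrite /S/= subr0.
have SK z : S z -> phi z <= M -> K z.
  move=> _; rewrite /phi => h.
  have h1 : enorm z.1 <= B1.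
    apply: psi_bounded => //; apply: le_trans h; rewrite lerDl.
    by rewrite mulr_ge0 ?dotvv_ge0// ltW.
  split => //=; apply: quadratic_bound => //.
    exact: enorm_ge0.
  rewrite enorm_sqr mul0r subr0.
  have := dot_cauchy (- c) z.1; rewrite dotNl enormN.
  have : 0 <= alpha * dot z.1 z.1 by rewrite mulr_ge0 ?dotvv_ge0// ltW.
  have := ler_wpM2l (enorm_ge0 c) h1.
  rewrite /psi in h; lra.
have [[w r] [Swr wrmin]] := coercive_min Scl Kc phic S0 SK.
rewrite /S/= in Swr.
pose l := (2 * rho) *: r.
have lE : (2 * rho)^-1 *: l = r by rewrite scalerA mulVf ?scale1r// gt_eqF//; lra.
(* move w to w + h and r to r + hG, so that the point wG + b - r of T stays *)
pose p := c + (2 * alpha) *: w + l *m G^T.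
have var h : 0 <= dot p h + (alpha * dot h h + rho * dot (h *m G) (h *m G)).
  have := wrmin (w + h, r + h *m G); rewrite /S /phi /psi /=.
  have -> : (w + h) *m G + b - (r + h *m G) = w *m G + b - r.
    by rewrite mulmxDl; apply/rowP => i; rewrite !mxE; ring.
  move=> /(_ Swr).
  rewrite /p (dotDl _ _ h) [dot (l *m _) h]dotC -dot_mulmx (dotC _ l) /l.
  rewrite !dotE (dotC h w) (dotC (h *m G) r); lra.
have p0 : p = 0.
  clearbody p; apply: dotvv_eq0; apply/eqP.
  rewrite eq_le dotvv_ge0 andbT leNgt.
  apply/negP => pp.
  set Q := alpha * dot p p + rho * dot (p *m G) (p *m G).
  have Q0 : 0 < Q.
    by apply: ltr_pwDl; [exact: mulr_gt0|rewrite mulr_ge0 ?dotvv_ge0// ltW].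
  pose s := dot p p / (2 * Q).
  have s0 : 0 < s by rewrite divr_gt0//; lra.
  have sQ : s * Q = dot p p / 2 by rewrite /s; field; rewrite gt_eqF.
  have := var (- s *: p); rewrite -scalemxAl !dotE => h.
  have : s * dot p p <= s * (s * Q) by rewrite /Q; lra.
  by rewrite ler_pM2l// sQ; lra.
exists w, l; rewrite lE; split => //.
- have -> : l = (2 * rho) *: ((w *m G + b) - (w *m G + b - r)).
    by rewrite subKr.
  apply: regular_normalZ; first by lra.
  apply: regular_normal_nearest => // y Ty.
  rewrite subKr; apply: ler_sqr_enorm.
  have := wrmin (w, w *m G + b - y); rewrite /S /phi /= subKr.
  by move=> /(_ Ty); rewrite lerD2l ler_pM2l.
- have [w' [Tw' w'w]] := error_bound w Swr.
  rewrite subKr in w'w.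
  have := wrmin (w', 0); rewrite /S /phi /psi /= subr0 => /(_ Tw').
  rewrite dot0l mulr0 addr0.
  pose z := w' - w; have w'E : w' = w + z by rewrite /z addrC subrK.
  rewrite -/z in w'w; rewrite w'E; clearbody z.
  have hz := dot_cauchy (c + (2 * alpha) *: w) z.
  have -> : enorm l = 2 * rho * enorm r by rewrite /l enormZ gtr0_norm//; lra.
  set N := enorm (c + _) in hz *.
  have N0 : 0 <= N by exact: enorm_ge0.
  move: hz; rewrite !dotE (dotC z w) => hz hmin.
  have z2 : dot z z <= kappa ^+ 2 * enorm r ^+ 2.
    by rewrite -enorm_sqr -exprMn lerXn2r ?nnegrE ?enorm_ge0// mulr_ge0 ?enorm_ge0.
  have h1 : rho * enorm r ^+ 2 <= N * (kappa * enorm r) + alpha * dot z z.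
    rewrite enorm_sqr; have := ler_wpM2l N0 w'w; lra.
  have h2 : alpha * dot z z <= rho / 2 * enorm r ^+ 2.
    apply: (le_trans (ler_wpM2l (ltW a0) z2)).
    by rewrite mulrA ler_wpM2r ?sqr_ge0//; lra.
  have := enorm_ge0 r; rewrite le_eqVlt => /orP[/eqP<-|rr0].
    by rewrite mulr0 !mulr_ge0.
  rewrite -(ler_pM2r rr0); lra.
- move=> w' Tw'; have := wrmin (w', 0); rewrite /S /phi /= subr0 => /(_ Tw').
  by rewrite dot0l; have := dotvv_ge0 r; nra.
Qed.

(** Let rho tend to infinity: the residual tends to 0, which makes the limit point
    exactly feasible; this is why the multiplier is a normal of T at a point of
    the image of the feasible set, and not merely at some point of T. *)
Let multiplier_regularized alpha : 0 < alpha ->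
  exists w l, [/\ T (w *m G + b), limiting_normal T (w *m G + b) l,
    c + (2 * alpha) *: w + l *m G^T = 0,
    enorm l <= 4 * kappa * enorm (c + (2 * alpha) *: w) &
    forall w', T (w' *m G + b) -> psi alpha w <= psi alpha w'].
Proof.
move=> a0; pose rho (k : nat) : R := 2 * alpha * kappa ^+ 2 + k.+1%:R.
have ak : 0 <= 2 * alpha * kappa ^+ 2 by rewrite !mulr_ge0 ?sqr_ge0// ltW.
have rho_gt0 k : 0 < rho k by rewrite ltr_wpDl.
have /choice[w_ /choice[l_ h]] : forall k, exists w l,
   [/\ regular_normal T (w *m G + b - (2 * rho k)^-1 *: l) l,
    c + (2 * alpha) *: w + l *m G^T = 0,
    enorm l <= 4 * kappa * enorm (c + (2 * alpha) *: w) &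
    forall w', T (w' *m G + b) -> psi alpha w <= psi alpha w'].
  by move=> k; apply: multiplier_penalized => //; rewrite /rho lerDl.
have wB k : enorm (w_ k) <= 1 + (enorm c + `|psi alpha w0|) / alpha.
  by apply: psi_bounded => //; have [_ _ _] := h k; exact.
set B := 1 + _ in wB.
have lB k : enorm (l_ k) <= 4 * kappa * (enorm c + 2 * alpha * B).
  have [_ _ hl _] := h k; apply: (le_trans hl); rewrite ler_wpM2l ?mulr_ge0//.
  apply: (le_trans (enormD _ _)); rewrite lerD2l enormZ gtr0_norm; last by lra.
  by rewrite ler_wpM2l//; lra.
have [phi [w [hphi wc]]] := bounded_subseq wB.
have [chi [l [hchi lc]]] := bounded_subseq (fun k => lB (phi k)).
have hpc k : (k <= phi (chi k))%N by exact: leq_trans (hchi k) (hphi _).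
have {}wc : w_ (phi (chi k)) @[k --> \oo] --> w by exact: (cvg_subseq hchi wc).
have {}lc : l_ (phi (chi k)) @[k --> \oo] --> l by exact: lc.
have rc : (2 * rho (phi (chi k)))^-1 @[k --> \oo] --> (0 : R).
  have : (2 * rho k)^-1 @[k --> \oo] --> (0 : R).
    apply: cvg0_squeeze cvg_natSinv => k.
    have r2 : 0 < 2 * rho k by rewrite mulr_gt0.
    rewrite invr_ge0 (ltW r2)/= lef_pV2 ?posrE//.
    by rewrite /rho; have := ler0n R k.+1; lra.
  exact: cvg_subseq hpc.
have uc : (w_ (phi (chi k)) *m G + b - (2 * rho (phi (chi k)))^-1 *: l_ (phi (chi k)))
    @[k --> \oo] --> w *m G + b.
  rewrite -[X in _ --> X]subr0 -(scale0r l); apply: cvgB; last exact: cvgZ.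
  by apply: cvgD; [exact: cvg_mulmx|exact: cvg_cst].
have Tw : T (w *m G + b).
  apply: (closed_cvg _ T_closed _ _ uc).
  by apply: (@filterE _ \oo) => k; case: (h (phi (chi k))) => -[].
have pc : c + (2 * alpha) *: w_ (phi (chi k)) @[k --> \oo] --> c + (2 * alpha) *: w.
  by apply: cvgD; [exact: cvg_cst|apply: cvgZ => //; exact: cvg_cst].
exists w, l; split => //.
- split=> //; exists (fun k => w_ (phi (chi k)) *m G + b -
    (2 * rho (phi (chi k)))^-1 *: l_ (phi (chi k))), (fun k => l_ (phi (chi k))).
  by split=> // k; case: (h (phi (chi k))) => // -[].
- have sc : (c + (2 * alpha) *: w_ (phi (chi k)) + l_ (phi (chi k)) *m G^T)
      @[k --> \oo] --> c + (2 * alpha) *: w + l *m G^T.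
    by apply: cvgD => //; exact: cvg_mulmx.
  by apply: (cvg_eq_cst _ sc) => k; case: (h (phi (chi k))).
- apply: (ler_cvg_to (cvg_enorm lc)).
    by apply: cvgM; [exact: cvg_cst|exact: cvg_enorm pc].
  by apply: filterE => k; case: (h (phi (chi k))).
- move=> w' Tw'.
  have psic : psi alpha (w_ (phi (chi k))) @[k --> \oo] --> psi alpha w.
    apply: cvgD; first by apply: cvg_dot => //; exact: cvg_cst.
    by apply: cvgM; [exact: cvg_cst|exact: cvg_dot].
  apply: (cvgr_to_le psic); apply: filterE => k.
  by have [_ _ _] := h (phi (chi k)); exact.
Qed.

(** Let the regularization alpha tend to 0.  Minimality bounds alpha |w|^2, hence
    alpha w tends to 0 even if w is unbounded, and the multipliers, bounded by
    alpha w and c, converge to l with c + l G^T = 0.  Their pairing with wG + b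
    is -c.w - 2 alpha |w|^2 + l'.b: the regularization enters with the favorable
    sign, and -c.w is at most beta. *)
Lemma linear_objective_multiplier beta :
  (forall w, T (w *m G + b) -> 0 <= dot c w + beta) ->
  exists l, c + l *m G^T = 0 /\ forall e, 0 < e -> exists w l',
    [/\ T (w *m G + b), limiting_normal T (w *m G + b) l', enorm (l' - l) < e &
    dot l' (w *m G + b) <= beta + dot l b + e].
Proof.
move=> hbeta; pose al (k : nat) : R := k.+1%:R^-1.
have al0 k : 0 < al k by rewrite invr_gt0.
have al1 k : al k <= 1 by rewrite invf_le1// ler1n.
have /choice[w_ /choice[l_ h]] := fun k => multiplier_regularized (al0 k).
pose M := enorm c * enorm w0 + dot w0 w0 + beta.
have aw2 k : dot (al k *: w_ k) (al k *: w_ k) <= al k * M.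
  rewrite !dotE ler_wpM2l ?(ltW (al0 k))//.
  have [Tw _ _ _ /(_ _ w0_feas)] := h k.
  have := hbeta _ Tw; have := dot_cauchy c w0.
  have := ler_wpM2r (dotvv_ge0 w0) (al1 k).
  by rewrite /psi /M; lra.
have aw : (al k *: w_ k) @[k --> \oo] --> (0 : 'rV[R]_n).
  apply: (@cvg_of_enorm _ _ _ _ (fun k => enorm (al k *: w_ k))).
    by move=> k; rewrite subr0.
  rewrite -(@sqrtr0 R).
  apply: (@continuous_cvg _ _ _ \oo _ (fun k => dot (al k *: w_ k) (al k *: w_ k))
    Num.sqrt); first exact: sqrt_continuous.
  apply: (@cvg0_squeeze _ _ (fun k => al k * M)).
    by move=> k; rewrite dotvv_ge0 aw2.
  by rewrite -(mul0r M); apply: cvgM; [exact: cvg_natSinv|exact: cvg_cst].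
have awB k : enorm (al k *: w_ k) <= Num.sqrt `|M|.
  rewrite /enorm ler_sqrt//; apply: (le_trans (aw2 k)).
  apply: (le_trans (ler_norm _)); rewrite normrM gtr0_norm//.
  by rewrite ler_piMl.
have lB k : enorm (l_ k) <= 4 * kappa * (enorm c + 2 * Num.sqrt `|M|).
  have [_ _ _ hl _] := h k; apply: (le_trans hl); rewrite ler_wpM2l ?mulr_ge0//.
  apply: (le_trans (enormD _ _)); rewrite lerD2l -scalerA enormZ gtr0_norm//.
  by rewrite ler_pM2l.
have [phi [l [hphi lc]]] := bounded_subseq lB.
have {}lc : l_ (phi k) @[k --> \oo] --> l by exact: lc.
have {}aw : (al (phi k) *: w_ (phi k)) @[k --> \oo] --> (0 : 'rV[R]_n).
  exact: (cvg_subseq hphi aw).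
exists l; split.
  have sc : (c + 2 *: (al (phi k) *: w_ (phi k)) + l_ (phi k) *m G^T)
      @[k --> \oo] --> c + 2 *: 0 + l *m G^T.
    apply: cvgD; last exact: cvg_mulmx.
    by apply: cvgD; [exact: cvg_cst|apply: cvgZ => //; exact: cvg_cst].
  rewrite scaler0 addr0 in sc.
  by apply: (cvg_eq_cst _ sc) => k; rewrite scalerA; case: (h (phi k)).
move=> e e0.
have bc : dot (l_ (phi k)) b @[k --> \oo] --> dot l b.
  by apply: cvg_dot => //; exact: cvg_cst.
have [k [lk bk]] : exists k, enorm (l_ (phi k) - l) < e /\
    dot (l_ (phi k)) b < dot l b + e.
  apply: (@filter_ex _ \oo); apply: filterI; first exact: enorm_cvgP.
  by apply: (cvgr_lt _ bc); rewrite ltrDl.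
have [Tw Nl st _ _] := h (phi k).
exists (w_ (phi k)), (l_ (phi k)); split => //.
rewrite dotDr [dot _ (_ *m _)]dotC dot_mulmx.
have := hbeta _ Tw.
have : dot (c + (2 * al (phi k)) *: w_ (phi k) + l_ (phi k) *m G^T) (w_ (phi k)) = 0.
  by rewrite st /dot big1// => i _; rewrite mxE mul0r.
rewrite !dotE [dot (w_ _) (l_ _ *m _)]dotC.
have : 0 <= al (phi k) * dot (w_ (phi k)) (w_ (phi k)).
  by rewrite mulr_ge0 ?dotvv_ge0// ltW.
lra.
Qed.

End Duality.

(** * Second-order expansions *)

Section Differentials.
Context {R : realType} {n : nat}.
Implicit Types (f : 'rV[R]_n -> R) (x y d v w : 'rV[R]_n).

Lemma derive_grad f x v : differentiable f x -> 'D_v f x = dot (grad f x) v.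
Proof.
move=> df; rewrite deriveE// [in LHS](row_sum_delta v) linear_sum /dot.
by apply: eq_bigr => i _; rewrite linearZ /= !mxE /partial deriveE// mulrC.
Qed.

Lemma hess2E f x d : hess2 f x d = dot (d *m hess f x) d.
Proof. by rewrite /hess2 mxE; apply: eq_bigr => i _; rewrite !mxE. Qed.

Lemma hess2_grad f x d :
  hess2 f x d = \sum_i d 0 i * dot (grad (partial i f) x) d.
Proof.
rewrite hess2E /dot; under eq_bigr do rewrite mxE mulr_suml.
rewrite exchange_big; apply: eq_bigr => i _ /=.
rewrite mulr_sumr; apply: eq_bigr => j _.
by rewrite !mxE mulrA.
Qed.

Lemma differentiable_near f x : differentiable f x -> forall e, 0 < e ->
  \forall h \near (0 : 'rV[R]_n),
    `|f (x + h) - f x - dot (grad f x) h| <= e * enorm h.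
Proof.
move=> df e e0; have /eqaddoP/(_ _ e0) := diff_locally df.
apply: filterS => h /=; rewrite -[X in `|X|]/(f (h + x) - (f x + 'd f x h)).
rewrite -(deriveE h df) derive_grad// opprD addrA (addrC h).
by move/le_trans; apply; rewrite ler_wpM2l ?norm_le_enorm ?ltW.
Qed.

Lemma is_derive_line f x y (s : R) : differentiable f (x + s *: y) ->
  is_derive s 1 (fun s => f (x + s *: y)) (dot (grad f (x + s *: y)) y).
Proof.
move=> df; have lineE : (fun h : R => h^-1 *: (f (h *: y + (x + s *: y)) - f (x + s *: y))) =
    (fun h : R => h^-1 *: (f (x + (h *: 1 + s) *: y) - f (x + s *: y))).
  apply/funext => h; congr (_ *: (f _ - _)).
  by rewrite [h *: 1]mulr1 scalerDl addrCA.
have dv := @diff_derivable _ _ _ _ _ y df.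
split; first by move: dv; rewrite /derivable lineE.
by rewrite -derive_grad// /derive lineE.
Qed.

(** The remainder along the segment from x to x + y has at parameter s the
    derivative  sum_i y_i (D_i f(x + s y) - D_i f(x) - s D(D_i f)(x) y),  and each
    factor is o(|y|) by differentiability of D_i f at x. *)
Lemma taylor2 f x : C2 f -> forall e, 0 < e ->
  \forall y \near (0 : 'rV[R]_n),
    `|f (x + y) - f x - dot (grad f x) y - 2^-1 * hess2 f x y| <= e * dot y y.
Proof.
move=> [[df _] d2f] e e0.
pose e' := e / n.+1%:R.
have e'0 : 0 < e' by rewrite divr_gt0.
have near_i i : \forall h \near (0 : 'rV[R]_n), `|partial i f (x + h) -
    partial i f x - dot (grad (partial i f) x) h| <= e' * enorm h.
  by apply: differentiable_near => //; exact: (d2f i).1.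
have [r r0 hr] := nbhs_enorm (filter_forall _ near_i); near=> y.
have yr : enorm y < r.
  by have : enorm (y - 0) < r; [near: y; exact: near_enorm|rewrite subr0].
pose rho (s : R) := f (x + s *: y) - dot (grad f x) y * s - 2^-1 * hess2 f x y * (s ^+ 2).
pose drho (s : R) := dot (grad f (x + s *: y)) y - dot (grad f x) y - hess2 f x y * s.
have rhoD (s : R) : is_derive s 1 rho (drho s).
  have := is_derive_line (df (x + s *: y)) => dline.
  rewrite /rho; apply: is_derive_eq.
  by rewrite /drho /GRing.scale /=; field.
have [|s s01 rho1] := @MVT_segment R rho drho 0 1 ler01 (fun s _ => rhoD s).
  by apply: derivable_within_continuous => s _; case: (rhoD s).
have -> : f (x + y) - f x - dot (grad f x) y - 2^-1 * hess2 f x y = drho s.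
  move: rho1; rewrite subr0 mulr1 => <-.
  by rewrite /rho scale1r scale0r addr0; ring.
have {rho1 s01}[s0 s1] : 0 <= s /\ s <= 1 by move: s01; rewrite in_itv/= => /andP.
have -> : drho s = \sum_i y 0 i * (partial i f (x + s *: y) - partial i f x
    - dot (grad (partial i f) x) (s *: y)).
  rewrite /drho hess2_grad /dot mulr_suml -!sumrB; apply: eq_bigr => i _.
  rewrite -/(dot _ _) -/(dot _ _) dotZr !mxE.
  ring.
have sy : enorm (s *: y) <= enorm y.
  by rewrite enormZ ger0_norm// ler_piMl ?enorm_ge0.
apply: (le_trans (ler_norm_sum _ _ _)).
apply: (@le_trans _ _ (\sum_(i < n) e' * dot y y)).
  apply: ler_sum => i _; rewrite normrM.
  have := hr (s *: y); rewrite subr0 => /(_ (le_lt_trans sy yr) i) hi.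
  have yi : `|y 0 i| <= enorm y.
    exact: le_trans (coord_le_norm _ _) (norm_le_enorm _).
  apply: (@le_trans _ _ (enorm y * (e' * enorm y))).
    apply: ler_pM => //; apply: (le_trans hi); by rewrite ler_pM2l.
  by rewrite -enorm_sqr; lra.
rewrite sumr_const card_ord -mulrnAl -mulr_natr /e'.
apply: ler_wpM2r; first exact: dotvv_ge0.
by rewrite mulrAC ler_pdivrMr// ler_pM2l// ler_nat.
Unshelve. all: by end_near. Qed.

(** Apply [taylor2] to the increments t_k z_k with z_k = d + t_k/2 w_k: the gradient
    contributes t_k D f(x) d and the second-order term D f(x) w_k, the Hessian
    contributes its value at z_k, which tends to d. *)
Lemma taylor2_arc f x d w (t : nat -> R) (w_ : nat -> 'rV[R]_n) :
  C2 f -> downto0 t -> w_ @ \oo --> w ->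
  (2 / t k ^+ 2 * (f (x + t k *: d + (2^-1 * t k ^+ 2) *: w_ k) - f x
     - t k * dot (grad f x) d)) @[k --> \oo] --> dot (grad f x) w + hess2 f x d.
Proof.
move=> f2 [t0 tc] wc.
pose z k := d + (2^-1 * t k) *: w_ k.
have zc : z @ \oo --> d.
  rewrite -[X in _ --> X]addr0; apply: cvgD; first exact: cvg_cst.
  rewrite -(scale0r w); apply: cvgZ => //.
  by rewrite -(mulr0 (2^-1 : R)); apply: cvgM => //; exact: cvg_cst.
have tzc : t k *: z k @[k --> \oo] --> (0 : 'rV[R]_n).
  by rewrite -(scale0r d); exact: cvgZ.
have hc : dot (grad f x) (w_ k) + hess2 f x (z k) @[k --> \oo] -->
    dot (grad f x) w + hess2 f x d.
  apply: cvgD; first by apply: cvg_dot => //; exact: cvg_cst.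
  under eq_fun do rewrite hess2E.
  by rewrite hess2E; apply: cvg_dot => //; exact: cvg_mulmx.
apply: cvg_sub0 hc; apply/cvgrPdist_le => e e0.
have zz : dot (z k) (z k) @[k --> \oo] --> dot d d by exact: cvg_dot.
pose e' := e / (2 * (dot d d + 1)).
have d0 : 0 < dot d d + 1 by rewrite ltr_wpDl ?dotvv_ge0.
have e'0 : 0 < e' by rewrite divr_gt0// mulr_gt0.
near=> k.
rewrite sub0r normrN !fctE.
have zk : dot (z k) (z k) <= dot d d + 1.
  by near: k; apply: (cvgr_le _ zz); rewrite ltrDl.
have : `|f (x + t k *: z k) - f x - dot (grad f x) (t k *: z k) -
    2^-1 * hess2 f x (t k *: z k)| <= e' * dot (t k *: z k) (t k *: z k).
  by near: k; exact: tzc (taylor2 x f2 e'0).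
have tk0 : t k != 0 by rewrite gt_eqF.
have -> : x + t k *: d + (2^-1 * t k ^+ 2) *: w_ k = x + t k *: z k.
  by apply/rowP => i; rewrite !mxE; ring.
have hE : hess2 f x (t k *: z k) = t k ^+ 2 * hess2 f x (z k).
  by rewrite !hess2E -scalemxAl dotZl dotZr; ring.
have gE : dot (grad f x) (t k *: z k) =
    t k * dot (grad f x) d + 2^-1 * t k ^+ 2 * dot (grad f x) (w_ k).
  by rewrite /z !dotE; ring.
rewrite hE gE => h.
have -> : (2 / t k ^+ 2 * (f (x + t k *: z k) - f x - t k * dot (grad f x) d) -
    (dot (grad f x) (w_ k) + hess2 f x (z k))) =
  2 / t k ^+ 2 * (f (x + t k *: z k) - f x - (t k * dot (grad f x) d +
     2^-1 * t k ^+ 2 * dot (grad f x) (w_ k)) - 2^-1 * (t k ^+ 2 * hess2 f x (z k))).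
  by field.
rewrite normrM gtr0_norm; last by rewrite divr_gt0// exprn_gt0.
rewrite mulrAC ler_pdivrMr ?exprn_gt0//.
have h2 : e' * dot (t k *: z k) (t k *: z k) <= t k ^+ 2 * (e / 2).
  rewrite dotZl dotZr; have -> : e / 2 = e' * (dot d d + 1).
    by rewrite /e'; field; rewrite gt_eqF.
  have -> : e' * (t k * (t k * dot (z k) (z k))) = t k ^+ 2 * (e' * dot (z k) (z k)).
    by ring.
  by rewrite ler_pM2l ?exprn_gt0// ler_pM2l.
by have := le_trans h h2; lra.
Unshelve. all: by end_near. Qed.

End Differentials.

Section VectorDifferentials.
Context {R : realType} {n m : nat}.
Variable g : 'rV[R]_n -> 'rV[R]_m.
Hypothesis g_C2 : C2vec g.

Lemma C2vec_differentiable x : differentiable g x.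
Proof.
have -> : g = \sum_(i < m) (fun x => g x 0 i *: delta_mx 0 i).
  by apply/funext => y; rewrite fct_sumE; exact: row_sum_delta.
apply: differentiable_sum => i; apply: differentiableZl.
exact: (g_C2 i).1.1.
Qed.

Lemma jacobianE x v i : (v *m 'J g x) 0 i = dot (grad (fun y => g y 0 i) x) v.
Proof.
rewrite -deriveEjacobian; last exact: C2vec_differentiable.
rewrite derive_mx; last exact/diff_derivable/C2vec_differentiable.
by rewrite mxE derive_grad//; exact: (g_C2 i).1.1.
Qed.

Lemma taylor2_arc_vec (x d w : 'rV[R]_n) (t : nat -> R) (w_ : nat -> 'rV[R]_n) :
  downto0 t -> w_ @ \oo --> w ->
  ((2 / t k ^+ 2) *: (g (x + t k *: d + (2^-1 * t k ^+ 2) *: w_ k) - g x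
     - t k *: (d *m 'J g x))) @[k --> \oo] --> w *m 'J g x + hess2vec g x d.
Proof.
move=> t0 wc; apply: cvg_row => i.
have -> : (w *m 'J g x + hess2vec g x d) 0 i =
    dot (grad (fun y => g y 0 i) x) w + hess2 (fun y => g y 0 i) x d.
  by rewrite mxE jacobianE mxE.
have := jacobianE x d i; move: (d *m _) => d' d'E.
under eq_fun do rewrite !mxE d'E.
exact: (@taylor2_arc _ _ (fun y => g y 0 i)).
Qed.

End VectorDifferentials.

(** * Second-order tangents of the feasible set *)

Lemma add_subr2 (V : zmodType) (a b u : V) : a + b + (u - a - b) = u.
Proof. by rewrite -(addrA u) -opprD subrKC. Qed.

Section SecondOrderTangents.
Context {R : realType} {n m : nat}.
Variables (g : 'rV[R]_n -> 'rV[R]_m) (Lam : set 'rV[R]_m) (x d : 'rV[R]_n).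
Hypothesis g_C2 : C2vec g.

Let T := tangent2 Lam (g x) (d *m 'J g x).

Lemma arc_cvg (w : 'rV[R]_n) (t : nat -> R) (w_ : nat -> 'rV[R]_n) :
  downto0 t -> w_ @ \oo --> w ->
  t k *: d + (2^-1 * t k ^+ 2) *: w_ k @[k --> \oo] --> (0 : 'rV[R]_n).
Proof.
move=> [_ tc] wc; rewrite -[X in _ --> X]addr0 -{1}(scale0r d) -(scale0r w).
apply: cvgD; first by apply: cvgZ => //; exact: cvg_cst.
apply: cvgZ => //; rewrite -(mulr0 (2^-1 : R)); apply: cvgM; first exact: cvg_cst.
by rewrite -(mulr0 (0 : R)); under eq_fun do rewrite expr2; exact: cvgM.
Qed.

Lemma tangent2_feasible w : tangent2 (feasible g Lam) x d w ->
  T (w *m 'J g x + hess2vec g x d).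
Proof.
move=> [t [w_ [t0 wc Fk]]].
exists t, (fun k => (2 / t k ^+ 2) *: (g (x + t k *: d + (2^-1 * t k ^+ 2) *: w_ k)
  - g x - t k *: (d *m 'J g x))); split => //; first exact: taylor2_arc_vec.
move=> k; rewrite scalerA; have tk := t0.1 k.
have -> : 2^-1 * t k ^+ 2 * (2 / t k ^+ 2) = 1 by field; rewrite gt_eqF.
by rewrite scale1r add_subr2; exact: Fk.
Qed.

Lemma tangent2_second_order (f : 'rV[R]_n -> R) w : C2 f ->
  local_solution f g Lam x -> dot (grad f x) d <= 0 ->
  tangent2 (feasible g Lam) x d w -> 0 <= dot (grad f x) w + hess2 f x d.
Proof.
move=> f2 [_ xmin] fd [t [w_ [t0 wc Fk]]].
apply: (cvgr_to_ge (@taylor2_arc _ _ f x d _ _ _ f2 t0 wc)).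
have ac : x + (t k *: d + (2^-1 * t k ^+ 2) *: w_ k) @[k --> \oo] --> x.
  rewrite -[X in _ --> X]addr0; apply: cvgD; first exact: cvg_cst.
  exact: (arc_cvg t0 wc).
near=> k.
have : feasible g Lam (x + (t k *: d + (2^-1 * t k ^+ 2) *: w_ k)) ->
    f x <= f (x + (t k *: d + (2^-1 * t k ^+ 2) *: w_ k)).
  by near: k; exact: ac xmin.
rewrite addrA => /(_ (Fk k)) fx.
rewrite mulr_ge0 ?divr_ge0 ?sqr_ge0//.
by have := mulr_ge0_le0 (ltW (t0.1 k)) fd; lra.
Unshelve. all: by end_near. Qed.

(** The arcs t d + t^2/2 w leave the origin in direction d, so subregularity in
    direction d controls them.  When d = 0 the second condition of [dir_nbhd]
    is void. *)
Lemma near_dir_nbhd (rho delta : R) w (t : nat -> R) :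
  0 < rho -> 0 < delta -> downto0 t ->
  \forall k \near \oo, dir_nbhd rho delta d (t k *: d + (2^-1 * t k ^+ 2) *: w).
Proof.
move=> rho0 delta0 t0.
have yc : t k *: d + (2^-1 * t k ^+ 2) *: w @[k --> \oo] --> (0 : 'rV[R]_n).
  by apply: (@arc_cvg w _ (fun=> w) t0); exact: cvg_cst.
have near1 : \forall k \near \oo, enorm (t k *: d + (2^-1 * t k ^+ 2) *: w) < rho.
  by apply: filterS (enorm_cvgP yc rho0) => k; rewrite subr0.
have [d0|d0] := eqVneq d 0.
  apply: filterS near1 => k yk; split => //.
  by rewrite d0 !enorm0 !scaler0 scale0r subr0 enorm0 mulr0.
have ed : 0 < enorm d.
  rewrite lt_neqAle enorm_ge0 andbT eq_sym.
  by apply: contra_neq d0; exact: enorm_eq0.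
pose z k := d + (2^-1 * t k) *: w.
have zc : z @ \oo --> d.
  rewrite -[X in _ --> X]addr0; apply: cvgD; first exact: cvg_cst.
  rewrite -(scale0r w); apply: cvgZ; last exact: cvg_cst.
  by rewrite -(mulr0 (2^-1 : R)); apply: cvgM; [exact: cvg_cst|exact: t0.2].
have ezc : enorm (z k) @[k --> \oo] --> enorm d by exact: cvg_enorm.
have lc : enorm (enorm d *: z k - enorm (z k) *: d) @[k --> \oo] --> (0 : R).
  rewrite -(enorm0 (n := n)) -(subrr (enorm d *: d)); apply: cvg_enorm.
  by apply: cvgB; apply: cvgZ; [exact: cvg_cst|exact: zc|exact: ezc|exact: cvg_cst].
have near2 : \forall k \near \oo, enorm d / 2 < enorm (z k).
  by apply: (cvgr_gt _ ezc); lra.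
have near3 : \forall k \near \oo, enorm (enorm d *: z k - enorm (z k) *: d) <
    delta * (enorm d / 2) * enorm d.
  by apply: (cvgr_lt _ lc); rewrite !mulr_gt0//; lra.
near=> k; split; first by near: k.
have -> : t k *: d + (2^-1 * t k ^+ 2) *: w = t k *: z k.
  by apply/rowP => i; rewrite !mxE; ring.
have tk := t0.1 k.
rewrite enormZ gtr0_norm// -scalerA [_ *: (t k *: _)]scalerA (mulrC _ (t k)).
rewrite -scalerA -scalerBr enormZ gtr0_norm//.
rewrite [leRHS](_ : _ = t k * (delta * enorm (z k) * enorm d)); last by ring.
rewrite ler_pM2l//.
have zk : enorm d / 2 < enorm (z k) by near: k.
have lk : enorm (enorm d *: z k - enorm (z k) *: d) <
    delta * (enorm d / 2) * enorm d by near: k.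
by apply: (le_trans (ltW lk)); rewrite ler_pM2r// ler_pM2l// ltW.
Unshelve. all: by end_near. Qed.

(** Directional subregularity of the nonlinear constraint becomes an error bound,
    valid for all w, for the linearized constraint wJ + b in T.  Given s in T,
    along the same t_k the distance of g(x + t d + t^2/2 w) to Lam is
    t^2/2 (|wJ + b - s| + o(1)); hence there are feasible points at distance at
    most kappa t^2/2 (|wJ + b - s| + o(1)), which rescale to points w_k that
    cluster at the required w'. *)
Lemma tangent2_error_bound : dir_subregular g Lam x d ->
  exists kappa : R, 0 <= kappa /\ forall w s, T s -> exists w',
    tangent2 (feasible g Lam) x d w' /\
    enorm (w' - w) <= kappa * enorm (w *m 'J g x + hess2vec g x d - s).
Proof.
move=> [kappa [rho [delta [kappa0 rho0 delta0 sub]]]].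
exists kappa; split; first exact: ltW.
move=> w s [t [s_ [t0 sc Lk]]].
set E := enorm (w *m 'J g x + hess2vec g x d - s).
pose q k := (2 / t k ^+ 2) *: (g (x + t k *: d + (2^-1 * t k ^+ 2) *: w) - g x
  - t k *: (d *m 'J g x)).
have qc : enorm (q k - s_ k) @[k --> \oo] --> E.
  apply: cvg_enorm; apply: cvgB => //.
  by apply: (taylor2_arc_vec (w_ := fun=> w) g_C2) => //; exact: cvg_cst.
(* eta absorbs both the o(1) term and the non-attainment of the distance *)
have step eta : 0 < eta -> exists r w', [/\ 0 < r < eta,
    enorm (w' - w) <= kappa * E + (kappa + 1) * eta &
    feasible g Lam (x + r *: d + (2^-1 * r ^+ 2) *: w')].
  move=> eta0.
  have [k [[tk qk] dk]] : exists k, (t k < eta /\ enorm (q k - s_ k) < E + eta) /\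
      dir_nbhd rho delta d (t k *: d + (2^-1 * t k ^+ 2) *: w).
    apply: (@filter_ex _ \oo); apply: filterI; first apply: filterI.
    - exact: (cvgr_lt _ t0.2).
    - by apply: (cvgr_lt _ qc); rewrite ltrDl.
    - exact: near_dir_nbhd.
  have tk0 := t0.1 k; set r := t k in tk tk0 dk *.
  have r2 : 0 < 2^-1 * r ^+ 2 by rewrite mulr_gt0// exprn_gt0.
  have qE : g (x + r *: d + (2^-1 * r ^+ 2) *: w) -
      (g x + r *: (d *m 'J g x) + (2^-1 * r ^+ 2) *: s_ k) =
      (2^-1 * r ^+ 2) *: (q k - s_ k).
    rewrite /q -/r scalerBr scalerA.
    have -> : 2^-1 * r ^+ 2 * (2 / r ^+ 2) = 1 by field; rewrite gt_eqF.
    by rewrite scale1r !opprD !addrA.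
  have hd : (Defs.edist (x + (r *: d + (2^-1 * r ^+ 2) *: w)) (feasible g Lam) <
      (2^-1 * r ^+ 2 * (kappa * (E + eta) + eta))%:E)%E.
    apply: (le_lt_trans (sub _ dk)).
    apply: (@le_lt_trans _ _ (kappa * (2^-1 * r ^+ 2 * (E + eta)))%:E).
      rewrite EFinM lee_pmul2l ?lte_fin//.
      apply: (le_trans (edist_le _ (Lk k))); rewrite lee_fin addrA qE enormZ.
      by rewrite gtr0_norm// ler_pM2l// ltW.
    by rewrite lte_fin; nra.
  have [z [Fz zx]] := edist_lt hd.
  pose c := (2^-1 * r ^+ 2).
  pose w' := c^-1 *: (z - x - r *: d).
  have c0 : c != 0 by rewrite gt_eqF.
  exists r, w'; split; first by rewrite tk0.
  - have -> : w' - w = - (c^-1 *: (x + (r *: d + c *: w) - z)).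
      by rewrite /w'; apply/rowP => i; rewrite !mxE; field.
    rewrite enormN enormZ gtr0_norm ?invr_gt0// ler_pdivrMl//.
    by apply: (le_trans (ltW zx)); rewrite ler_pM2l//; lra.
  - by rewrite -/c /w' scalerA mulfV// scale1r add_subr2.
have /choice[t' /choice[w_ h]] : forall k : nat, exists r w', [/\ 0 < r < k.+1%:R^-1,
    enorm (w' - w) <= kappa * E + (kappa + 1) * k.+1%:R^-1 &
    feasible g Lam (x + r *: d + (2^-1 * r ^+ 2) *: w')].
  by move=> k; apply: step; rewrite invr_gt0.
have wB k : enorm (w_ k) <= enorm w + (kappa * E + (kappa + 1)).
  apply: (le_trans (enorm_sub _ w)); rewrite lerD2l.
  have [_ hk _] := h k; apply: (le_trans hk); rewrite lerD2l ler_piMr//; first by lra.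
  by rewrite invf_le1// ler1n.
have [phi [w' [hphi wc]]] := bounded_subseq wB.
exists w'; split.
  exists (t' \o phi), (w_ \o phi); split => //; last by move=> k; case: (h (phi k)).
  by apply: downto0_subseq => //; apply: downto0_natSinv => k; case: (h k).
have wlim : enorm (w_ (phi k) - w) @[k --> \oo] --> enorm (w' - w).
  by apply: cvg_enorm; apply: cvgB; [exact: wc|exact: cvg_cst].
have blim : kappa * E + (kappa + 1) * (phi k).+1%:R^-1 @[k --> \oo] -->
    kappa * E + (kappa + 1) * 0.
  apply: cvgD; first exact: cvg_cst.
  apply: cvgM; first exact: cvg_cst.
  exact: (cvg_subseq hphi cvg_natSinv).
rewrite -[leRHS]addr0 -(mulr0 (kappa + 1)); apply: (ler_cvg_to wlim blim).
by apply: filterE => k; case: (h (phi k)).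
Qed.

End SecondOrderTangents.

(** * Derivatives of the Lagrangian *)

Section Lagrangian.
Context {R : realType} {n m : nat}.
Variables (f : 'rV[R]_n -> R) (g : 'rV[R]_n -> 'rV[R]_m) (l : 'rV[R]_m).
Hypothesis f_C2 : C2 f.
Hypothesis g_C2 : C2vec g.

Lemma derive_lincomb (f0 : 'rV[R]_n -> R) (h : 'I_m -> 'rV[R]_n -> R)
    (a : 'I_m -> R) x v :
  differentiable f0 x -> (forall j, differentiable (h j) x) ->
  'D_v (fun x => f0 x + \sum_j h j x * a j) x =
    'D_v f0 x + \sum_j 'D_v (h j) x * a j.
Proof.
move=> df dh.
have -> : (fun x => f0 x + \sum_j h j x * a j) = f0 + \sum_j (a j *: h j).
  by apply/funext => y; rewrite fctE fct_sumE; congr (_ + _);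
    apply: eq_bigr => j _; rewrite mulrC.
have dah j : derivable (a j *: h j) x v by apply/derivableZ/diff_derivable/dh.
rewrite deriveD; [|exact: diff_derivable|exact: derivable_sum].
rewrite derive_sum//; congr (_ + _); apply: eq_bigr => j _.
by rewrite deriveZ; [exact: mulrC|exact/diff_derivable/dh].
Qed.

Lemma partial_lagrangian i :
  partial i (fun x => lagrangian f g x l) =
  fun x => partial i f x + \sum_j partial i (fun y => g y 0 j) x * l 0 j.
Proof.
apply/funext => x; rewrite /partial derive_lincomb//; first exact: f_C2.1.1.
by move=> j; exact: (g_C2 j).1.1.
Qed.

Lemma grad_lagrangian x :
  grad (fun x => lagrangian f g x l) x = grad f x + l *m ('J g x)^T.
Proof.
apply/rowP => i; rewrite !mxE partial_lagrangian; congr (_ + _).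
apply: eq_bigr => j _; rewrite mulrC mxE; congr (_ * _).
have <- : (row i ('J g x)) 0 j = 'J g x i j by rewrite mxE.
rewrite rowE jacobianE// -derive_grad//; exact: (g_C2 j).1.1.
Qed.

Lemma hess2_sum (f0 : 'rV[R]_n -> R) x d :
  hess2 f0 x d = \sum_i \sum_j d 0 i * d 0 j * partial j (partial i f0) x.
Proof.
rewrite hess2_grad; apply: eq_bigr => i _; rewrite /dot mulr_sumr.
by apply: eq_bigr => j _; rewrite !mxE; ring.
Qed.

Lemma hess2_lagrangian x d :
  hess2 (fun x => lagrangian f g x l) x d =
  hess2 f x d + dot (hess2vec g x d) l.
Proof.
rewrite hess2_sum.
have E i j : partial j (partial i (fun x => lagrangian f g x l)) x =
    partial j (partial i f) x +
    \sum_k partial j (partial i (fun y => g y 0 k)) x * l 0 k.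
  rewrite partial_lagrangian {1}/partial derive_lincomb//.
    exact: (f_C2.2 i).1.
  by move=> k; exact: ((g_C2 k).2 i).1.
under eq_bigr do under eq_bigr do rewrite E mulrDr.
under eq_bigr do rewrite big_split.
rewrite big_split -hess2_sum; congr (_ + _) => /=.
under eq_bigr do under eq_bigr do rewrite mulr_sumr.
under eq_bigr do rewrite exchange_big.
rewrite exchange_big; apply: eq_bigr => k _ /=.
rewrite mxE hess2_sum mulr_suml; apply: eq_bigr => i _.
by rewrite mulr_suml; apply: eq_bigr => j _; rewrite mulrA.
Qed.

End Lagrangian.

(** * Lower support functions and the optimality condition *)

Lemma lower_support_on_le {R : realType} {m : nat} (T A : set 'rV[R]_m)
    (l : 'rV[R]_m) (a : R) :
  (forall e : R, 0 < e -> exists l' u, [/\ limiting_normal T u l', A u,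
    enorm (l' - l) < e & dot l' u <= a + e]) ->
  (lower_support_on T A l <= a%:E)%E.
Proof.
move=> h; rewrite /lower_support_on limf_einfE.
apply: ub_ereal_sup => _ [V /nbhs_enorm[r r0 hV] <-].
apply/lee_addgt0Pr => e e0.
have re0 : 0 < Num.min r e by rewrite lt_min r0 e0.
have [l' [u [Nu Au l'l le]]] := h _ re0.
have Vl' : V l' by apply: hV; rewrite (lt_le_trans l'l)// ge_min lexx.
apply: (@le_trans _ _ (dot l' u)%:E).
  apply: le_trans (ereal_inf_lbound _) (ereal_inf_lbound _).
  - by exists l'.
  - by exists u.
rewrite -EFinD lee_fin (le_trans le)// lerD2l.
by rewrite ge_min lexx orbT.
Qed.

Lemma lower_supportE {R : realType} {m : nat} (T : set 'rV[R]_m) l :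
  lower_support T l = lower_support_on T setT l.
Proof.
congr (limf_einf _ _); apply/funext => l'; congr (ereal_inf [set _ | _ in _]).
by apply/seteqP; split => u /=; [|case].
Qed.

Unset Implicit Arguments.

Theorem theorem2 (R : realType) (n m : nat)
    (f : 'rV[R]_n -> R) (g : 'rV[R]_n -> 'rV[R]_m) (Lam : set 'rV[R]_m)
    (xbar d : 'rV[R]_n)
    (f_C2 : C2 f) (g_C2 : C2vec g) (Lam_closed : closed Lam)
    (xbar_sol : local_solution f g Lam xbar)
    (d_crit : critical_cone f g Lam xbar d)
    (subreg : dir_subregular g Lam xbar d)
    (T2_nonempty : tangent2 Lam (g xbar) (d *m 'J g xbar) !=set0) :
  (exists l : 'rV[R]_m, dir_multipliers f g Lam xbar d l /\
    forall A : set 'rV[R]_m,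
      [set w *m 'J g xbar + hess2vec g xbar d
         | w in tangent2 (feasible g Lam) xbar d] `<=` A ->
      (0 <= (hess2 (fun x => lagrangian f g x l) xbar d)%:E
            - lower_support_on
                (tangent2 Lam (g xbar) (d *m 'J g xbar)) A l)%E)
  /\
  (exists l : 'rV[R]_m, dir_multipliers f g Lam xbar d l /\
    (0 <= (hess2 (fun x => lagrangian f g x l) xbar d)%:E
          - lower_support (tangent2 Lam (g xbar) (d *m 'J g xbar)) l)%E).
Proof.
set T := tangent2 Lam _ _; set b := hess2vec g xbar d.
have [kappa [kappa0 err]] := tangent2_error_bound g_C2 subreg.
(* with s = wG + b the right-hand side of the error bound vanishes *)
have feasE w : T (w *m 'J g xbar + b) -> tangent2 (feasible g Lam) xbar d w.
  move=> Tw; have [w' [Fw']] := err w _ Tw.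
  rewrite subrr enorm0 mulr0 => w'w.
  suff <- : w' = w by [].
  apply/eqP; rewrite -subr_eq0; apply/eqP/enorm_eq0/eqP.
  by rewrite eq_le w'w enorm_ge0.
have [s0 Ts0] := T2_nonempty.
have [w0 [/(tangent2_feasible g_C2) Tw0 _]] := err 0 s0 Ts0.
have [w s Ts|w /feasE Fw|l [stat approx]] := @linear_objective_multiplier R n m T ('J g xbar) b
    (grad f xbar) w0 kappa (@closed_tangent2 _ _ _ _ _) Tw0 kappa0 _ (hess2 f xbar d).
- have [w' [Fw' w'w]] := err w s Ts; exists w'; split => //.
  exact: tangent2_feasible.
- by apply: (tangent2_second_order f_C2 xbar_sol _ Fw); case: d_crit.
have mult : dir_multipliers f g Lam xbar d l.
  split; first by rewrite grad_lagrangian.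
  apply: (closed_enormP (@closed_dir_limiting_normal R m Lam (g xbar) _)).
  move=> e e0; have [w [l' [_ Nl' l'l _]]] := approx _ e0.
  by exists l' => //; exact: limiting_normal_tangent2 Nl'.
have main (A : set 'rV[R]_m) : [set w *m 'J g xbar + b
    | w in tangent2 (feasible g Lam) xbar d] `<=` A ->
    (0 <= (hess2 (fun x => lagrangian f g x l) xbar d)%:E - lower_support_on T A l)%E.
  move=> subA; rewrite sube_ge0 ?orbT//; apply: lower_support_on_le => e e0.
  have [w [l' [Tw Nl' l'l le]]] := approx _ e0.
  exists l', (w *m 'J g xbar + b); split => //.
    by apply: subA; exists w => //; exact: feasE.
  by rewrite hess2_lagrangian// (dotC _ l).
split; exists l; split => //.
by rewrite lower_supportE; apply: main.
Qed.
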